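(* Let $\mathcal{P}$ be a bounded above graded poset satisfying the standing assumptions listed in the context, for which there is an adequate covering family $\mathcal{J}$, and let $F_0=c_{\mathbb{Z}},F_1,F_2,\dots$ be the associated sequence of functors $\mathcal{P}\to\mathrm{Ab}$ described in the context. Then for each $p\ge0$ $$\varprojlim F_p\cong\varprojlim F_p|_{\mathcal{P}_{\{p+1,p\}}},$$ where $\mathcal{P}_{\{p+1,p\}}$ is the full subcategory of $\mathcal{P}$ on the objects of degree $p+1$ or $p$.
   Context: A poset is regarded as a category with exactly one arrow $p\to p'$ when $p\le p'$; $p$ precedes $p'$ if $p<p'$ and there is nothing strictly in between. Standing assumptions on $\mathcal{P}$: it is a poset with a decreasing degree function $\deg:\mathrm{Ob}(\mathcal{P})\to\{0,1,2,\dots\}$, i.e. $\deg$ is strictly order reversing and $\deg(p')=\deg(p)-1$ whenever $p$ precedes $p'$ (such a graded poset is bounded above); some object has degree $0$; all maximal elements have the same degree (hence degree $0$); and for every object $i$ and every $n$ the set $(i\downarrow\mathcal{P})_n$ of objects $j\ge i$ with $\deg(j)=n$ is finite. $(i\downarrow\mathcal{P})_*$ is the full subcategory on the objects $j>i$. Covering family: a family $\mathcal{J}=\{J^{i_0}_p\}$ indexed by objects $i_0$ and integers $0\le p\le\deg(i_0)$, with $J^{i_0}_p\subseteq(i_0\downarrow\mathcal{P})_p$, such that for each $i_0$ and $0\le p<\deg(i_0)$: (a) $\bigcup_{i\in J^{i_0}_{p+1}}(i\downarrow\mathcal{P})_p=(i_0\downarrow\mathcal{P})_p$; (b) $J^i_p\subseteq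 J^{i_0}_p$ for every $i\in J^{i_0}_{p+1}$. Define integers $R^{i_0}_p$ for $\deg(i_0)\ge p\ge 0$ by $R^{i_0}_0=1$ and $R^{i_0}_p=\sum_{i\in(i_0\downarrow\mathcal{P})_{p-1}}R^i_{p-1}-R^{i_0}_{p-1}$ for $p\ge1$. $\mathcal{J}$ is adequate if $(i_0\downarrow\mathcal{P})_*$ is connected whenever $\deg(i_0)\ge2$, and $R^{i_0}_p=\sum_{i\in J^{i_0}_p}R^i_p$ for all $p\ge0$ and all $i_0$ with $\deg(i_0)\ge p+1$. Functors $F_p$: $F_0=c_{\mathbb{Z}}$ is the constant functor with value $\mathbb{Z}$, and for $p\ge1$, $F_p(i_0)=\big(\prod_{i\in(i_0\downarrow\mathcal{P})_{p-1}}F_{p-1}(i)\big)/\lambda_{i_0}(F_{p-1}(i_0))$, where $\lambda_{i_0}=\prod_iF_{p-1}(i_0\to i)$, with $F_p(i_0\to i_1)$ induced by the projection determined by $(i_1\downarrow\mathcal{P})_{p-1}\subseteq(i_0\downarrow\mathcal{P})_{p-1}$. *)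

(* Defs.v *)
From HB Require Import structures.
From mathcomp Require Import all_boot all_order all_algebra.
From mathcomp Require Import boolp classical_sets functions cardinality fsbigop.

Set Implicit Arguments.
Unset Strict Implicit.
Unset Printing Implicit Defensive.

Import Order.TTheory GRing.Theory.

Local Open Scope classical_set_scope.
Local Open Scope ring_scope.
Local Open Scope order_scope.

(* An alias of the dependent product, carrying the pointwise group structure. *)
Definition dprod (I : Type) (V : I -> zmodType) : Type := forall i, V i.

Section DProd.
Variables (I : Type) (V : I -> zmodType).
Implicit Types f g h : dprod V.

HB.instance Definition _ := gen_eqMixin (dprod V).
HB.instance Definition _ := gen_choiceMixin (dprod V).

Let zero : dprod V := fun=> 0%R.
Let opp f : dprod V := fun i => (- f i)%R.
Let add f g : dprod V := fun i => (f i + g i)%R.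

Let addA : associative add.
Proof. by move=> f g h; apply: functional_extensionality_dep => i; exact: addrA. Qed.

Let addC : commutative add.
Proof. by move=> f g; apply: functional_extensionality_dep => i; exact: addrC. Qed.

Let add0 : left_id zero add.
Proof. by move=> f; apply: functional_extensionality_dep => i; exact: add0r. Qed.

Let addN : left_inverse zero opp add.
Proof. by move=> f; apply: functional_extensionality_dep => i; exact: addNr. Qed.

HB.instance Definition _ := GRing.isZmodule.Build (dprod V) addA addC add0 addN.

End DProd.

Section Coker.
Variables (U V : zmodType) (f : {additive U -> V}).

Definition im_pred : V -> bool := fun y => `[< exists x, f x = y >].

Lemma im_pred_zmod_closed : zmod_closed im_pred.
Proof.
split=> [|_ _ /asboolP[x <-] /asboolP[y <-]]; apply/asboolP.
  by exists 0%R; rewrite raddf0.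
by exists (x - y)%R; rewrite raddfB.
Qed.

HB.instance Definition _ := GRing.isZmodClosed.Build V im_pred im_pred_zmod_closed.

Definition coker : zmodType := Quotient.quot (GRing.ZmodClosed.clone V im_pred _).

Definition coker_pi : {additive V -> coker} := \pi_coker%qT.

Lemma coker_piP x y : coker_pi x = coker_pi y <-> exists u, f u = (x - y)%R.
Proof.
rewrite /coker_pi; split=> [/eqP|h]; last apply/eqP.
  by rewrite -Quotient.idealrBE => /asboolP.
by rewrite -Quotient.idealrBE; apply/asboolP.
Qed.

Lemma coker_pi_surj (q : coker) : exists x, coker_pi x = q.
Proof. by exists (repr q); exact: reprK. Qed.

End Coker.

Section CokerMap.
Variables (U V U' V' : zmodType).
Variables (f : {additive U -> V}) (f' : {additive U' -> V'}).
Variables (g : {additive U -> U'}) (h : {additive V -> V'}).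
Hypothesis fgh : forall x, h (f x) = f' (g x).

Definition coker_map_fun (q : coker f) : coker f' := coker_pi f' (h (repr q)).

Lemma coker_map_funE x : coker_map_fun (coker_pi f x) = coker_pi f' (h x).
Proof.
apply/coker_piP.
have /coker_piP[u fu] : coker_pi f (repr (coker_pi f x)) = coker_pi f x.
  exact: reprK.
by exists (g u); rewrite -fgh fu raddfB.
Qed.

Lemma coker_map_zmod_morphism : zmod_morphism coker_map_fun.
Proof.
move=> q r; have [[x <-] [y <-]] := (coker_pi_surj q, coker_pi_surj r).
by rewrite -raddfB !coker_map_funE !raddfB.
Qed.

Definition coker_map : {additive coker f -> coker f'} :=
  HB.pack coker_map_fun
    (GRing.isZmodMorphism.Build _ _ coker_map_fun coker_map_zmod_morphism).

Lemma coker_mapE x : coker_map (coker_pi f x) = coker_pi f' (h x).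
Proof. exact: coker_map_funE. Qed.

End CokerMap.

Record functor d (P : porderType d) := Functor {
  fobj :> P -> zmodType;
  fmap : forall i j : P, i <= j -> {additive fobj i -> fobj j};
  fmap_id : forall (i : P) (ii : i <= i) x, fmap ii x = x;
  fmap_comp : forall (i j k : P) (ij : i <= j) (jk : j <= k) (ik : i <= k) x,
    fmap ik x = fmap jk (fmap ij x) }.

Section Limit.
Variables (d : Order.disp_t) (P : porderType d) (F : functor P).

Definition compatible : dprod F -> bool := fun x =>
  `[< forall (i j : P) (ij : i <= j), fmap F ij (x i) = x j >].

Lemma compatible_zmod_closed : zmod_closed compatible.
Proof.
split=> [|x y /asboolP xP /asboolP yP]; apply/asboolP => i j ij.
  exact: raddf0.
by rewrite -[RHS]/(x j - y j)%R -(xP i j ij) -(yP i j ij) -raddfB.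
Qed.

HB.instance Definition _ :=
  GRing.isZmodClosed.Build (dprod F) compatible compatible_zmod_closed.

Record limit := Limit { limit_val :> dprod F; limitP : compatible limit_val }.

HB.instance Definition _ := [isSub for limit_val].
HB.instance Definition _ := [Choice of limit by <:].
HB.instance Definition _ := [SubChoice_isSubZmodule of limit by <:].

End Limit.

Section Subposet.
Variables (d : Order.disp_t) (P : porderType d) (A : set P).

Record subposet := Subposet { subposet_val :> P; _ : subposet_val \in A }.

HB.instance Definition _ := [isSub for subposet_val].
HB.instance Definition _ := [Choice of subposet by <:].
HB.instance Definition _ := [SubChoice_isSubPOrder of subposet by <: with d].

Definition restrict_functor (F : functor P) : functor subposet :=
  @Functor d subposet (fun i => F (val i))
    (fun i j (ij : i <= j) => fmap F (ij : val i <= val j))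
    (fun i ii => @fmap_id _ _ F (val i) ii)
    (fun i j k ij jk ik => @fmap_comp _ _ F (val i) (val j) (val k) ij jk ik).

End Subposet.

(* Connectedness as a category: nonempty, and any two objects are joined by a
   finite zigzag of arrows; [>=<] is comparability. *)
Definition poset_connected d (P : porderType d) : Prop :=
  (exists x : P, True) /\
  forall x y : P, exists2 s : seq P, path (>=<%O) x s & last x s = y.

Section Graded.
Variables (d : Order.disp_t) (P : porderType d) (deg : P -> nat).

Definition precedes (i j : P) : Prop := i < j /\ ~ (exists k, i < k < j).

Definition maximal_object (i : P) : Prop := forall j, i <= j -> j = i.

(* The set of objects of [i \downarrow P] of degree [n]. *)
Definition slice (i : P) (n : nat) : set P := [set j | i <= j /\ deg j = n].

Definition strictly_above (i : P) : set P := [set j | i < j].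

Record graded_poset : Prop := GradedPoset {
  deg_decr : forall i j, i < j -> (deg j < deg i)%N;
  deg_precedes : forall i j, precedes i j -> deg i = (deg j).+1;
  deg_has0 : exists i, deg i = 0%N;
  deg_maximal : forall i j, maximal_object i -> maximal_object j -> deg i = deg j;
  slice_finite : forall i n, finite_set (slice i n) }.

(* [J i p] is only meaningful for [p <= deg i]. *)
Record covering_family (J : P -> nat -> set P) : Prop := CoveringFamily {
  cover_sub : forall i p, (p <= deg i)%N -> J i p `<=` slice i p;
  cover_union : forall i0 p, (p < deg i0)%N ->
    \bigcup_(i in J i0 p.+1) slice i p = slice i0 p;
  cover_incl : forall i0 p, (p < deg i0)%N ->
    forall i, J i0 p.+1 i -> J i p `<=` J i0 p }.

(* Only meaningful for [p <= deg i0]; the sum is over a finite set as soon as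
   the slices are finite. *)
Fixpoint rk (p : nat) (i0 : P) : int :=
  if p is p'.+1 then (\sum_(i \in slice i0 p') rk p' i - rk p' i0)%R else 1%R.

Record adequate (J : P -> nat -> set P) : Prop := Adequate {
  adequate_connected : forall i0, (2 <= deg i0)%N ->
    poset_connected (subposet (strictly_above i0));
  adequate_rk : forall p i0, (p.+1 <= deg i0)%N ->
    rk p i0 = (\sum_(i \in J i0 p) rk p i)%R }.

Section Next.
Variables (F : functor P) (n : nat).

Definition slice_prod i0 : zmodType :=
  dprod (fun i : slice i0 n => F (val i)).

Lemma slice_le i0 (i : slice i0 n) : i0 <= val i.
Proof. by have [] := set_mem (valP i). Qed.

Definition lambda_fun i0 (x : F i0) : slice_prod i0 :=
  fun i => fmap F (slice_le i) x.

Lemma lambda_zmod_morphism i0 : zmod_morphism (@lambda_fun i0).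
Proof.
by move=> x y; apply: functional_extensionality_dep => i; exact: raddfB.
Qed.

Definition lambda i0 : {additive F i0 -> slice_prod i0} :=
  HB.pack (@lambda_fun i0)
    (GRing.isZmodMorphism.Build _ _ (@lambda_fun i0) (@lambda_zmod_morphism i0)).

Lemma slice_incl_subproof i0 i1 (h : i0 <= i1) (i : slice i1 n) :
  val i \in slice i0 n.
Proof.
by have [/(le_trans h) ? ?] := set_mem (valP i); apply/mem_set.
Qed.

Definition slice_incl i0 i1 (h : i0 <= i1) (i : slice i1 n) : slice i0 n :=
  exist _ (val i) (slice_incl_subproof h i).

Definition slice_proj_fun i0 i1 (h : i0 <= i1) (y : slice_prod i0) :
    slice_prod i1 :=
  fun i => y (slice_incl h i).

Lemma slice_proj_zmod_morphism i0 i1 (h : i0 <= i1) :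
  zmod_morphism (slice_proj_fun h).
Proof. by []. Qed.

Definition slice_proj i0 i1 (h : i0 <= i1) :
    {additive slice_prod i0 -> slice_prod i1} :=
  HB.pack (slice_proj_fun h)
    (GRing.isZmodMorphism.Build _ _ (slice_proj_fun h)
      (slice_proj_zmod_morphism h)).

Lemma slice_proj_lambda i0 i1 (h : i0 <= i1) x :
  slice_proj h (lambda i0 x) = lambda i1 (fmap F h x).
Proof.
by apply: functional_extensionality_dep => i; exact: fmap_comp.
Qed.

Definition next_map i0 i1 (h : i0 <= i1) :
    {additive coker (lambda i0) -> coker (lambda i1)} :=
  coker_map (slice_proj_lambda h).

Lemma next_map_id i (ii : i <= i) x : next_map ii x = x.
Proof.
have [y <-] := coker_pi_surj x; rewrite coker_mapE; congr (coker_pi _ _).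
apply: functional_extensionality_dep => -[j jP].
rewrite -[LHS]/(y (exist _ j _)); congr (y (exist _ j _)).
exact: bool_irrelevance.
Qed.

Lemma next_map_comp i j k (ij : i <= j) (jk : j <= k) (ik : i <= k) x :
  next_map ik x = next_map jk (next_map ij x).
Proof.
have [y <-] := coker_pi_surj x.
rewrite /next_map (coker_mapE (slice_proj_lambda ij)) !coker_mapE.
congr (coker_pi _ _).
apply: functional_extensionality_dep => -[l lP].
rewrite -[LHS]/(y (exist _ l _)) -[RHS]/(y (exist _ l _)).
by congr (y (exist _ l _)); exact: bool_irrelevance.
Qed.

(* The product over the degree-[n] part of [i0 \downarrow P] modulo the image of
   [F i0]; its value is [0] when [deg i0 <= n]. *)
Definition next_functor : functor P := Functor next_map_id next_map_comp.

End Next.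

Definition const_functor (V : zmodType) : functor P :=
  @Functor d P (fun=> V) (fun _ _ _ => idfun)
    (fun _ _ _ => erefl) (fun _ _ _ _ _ _ _ => erefl).

Fixpoint Fseq (p : nat) : functor P :=
  if p is p'.+1 then next_functor (Fseq p') p' else const_functor int.

End Graded.

(* Main.v *)
(* For [deg i > p] the restriction of [F_p i] to the product of the [F_p j],
   [j] in [J^i_p], is an isomorphism; both this and "[F_p i = 0] as soon as
   [R^i_p = 0]" are proved by induction on [p].  Given the isomorphism for [p],
   each class in [F_{p+1} i] has a unique representative vanishing on [J^i_p].
   By (b) this normal form restricts to the normal form for every [j] in
   [J^i_{p+1}], which with (a) gives injectivity.  The identity
   [R^i_{p+1} = \sum_{j in J^i_{p+1}} R^j_{p+1}] says that, up to elements [k]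
   with [R^k_p = 0], the sets [slice j p \ J^j_p] partition [slice i p \ J^i_p],
   so normal forms for the [j]'s glue.  In the limit, the value at [i] with
   [deg i > p] is then determined by the values on [J^i_p], and (a), (b) together
   with compatibility in degrees [p+1] and [p] show that the value so defined
   restricts correctly to all of degree [p]. *)

Require Import Defs.
From HB Require Import structures.
From mathcomp Require Import all_boot all_order all_algebra.
From mathcomp Require Import boolp classical_sets functions cardinality fsbigop.
Local Open Scope classical_set_scope.

Import Order.TTheory GRing.Theory Num.Theory.

Set Implicit Arguments.
Unset Strict Implicit.
Unset Printing Implicit Defensive.

(** * Sums over subsets of a finite list *)

(** Puts sums over different subsets of a slice on one common enumeration, where they can be
    subtracted and exchanged. *)
Lemma fsbig_seq_widen (T : choiceType) (A : set T) (s : seq T) (f : T -> int) :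
  uniq s -> (forall k, A k -> k \in s) ->
  (\sum_(k \in A) f k = \sum_(k <- s | k \in A) f k)%R.
Proof.
move=> us As.
rewrite (@fsbigE _ _ _ _ _ [seq k <- s | k \in A]) ?filter_uniq //.
- by rewrite big_filter_cond; apply: eq_bigl => k; rewrite andbb.
- by move=> k /=; rewrite mem_filter => /andP[/set_mem].
- by move=> k Ak; rewrite mem_filter (mem_set Ak) As.
Qed.

(** * Classes in the quotient defining the next functor *)

Section Next.
Variables (d : Order.disp_t) (P : porderType d) (deg : P -> nat).
Variables (F : functor P) (n : nat).
Implicit Types (i j k : P) (y : dprod F).

(* The class of the restriction to the slice of a family over the whole poset;
   total families make [fmap_cls] free of transports. *)
Definition cls i y : next_functor deg F n i :=
  coker_pi (lambda deg F n i) (fun v => y (val v)).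

Lemma fmap_cls i j (ij : (i <= j)%O) y :
  fmap (next_functor deg F n) ij (cls i y) = cls j y.
Proof. exact: coker_mapE. Qed.

Lemma slice_prod_extend i (w : slice_prod deg F n i) :
  exists y, w = fun v => y (val v).
Proof.
exists (fun k => if pselect (k \in slice deg i n) is left h return F k
  then w (exist _ k h) else 0%R).
apply: functional_extensionality_dep => -[k h] /=.
by case: pselect => // h'; rewrite (bool_irrelevance h h').
Qed.

Lemma cls_surj i (x : next_functor deg F n i) : exists y, cls i y = x.
Proof.
have [w <-] := coker_pi_surj x; have [y ->] := slice_prod_extend w.
by exists y.
Qed.

Lemma eq_cls i y y' :
  cls i y = cls i y' <->
  exists u : F i, forall k (ik : (i <= k)%O), deg k = n ->
    (fmap F ik u = y k - y' k)%R.
Proof.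
rewrite coker_piP; split=> -[u uP]; exists u.
  move=> k ik kn; have h : k \in slice deg i n by exact: mem_set.
  have <- : fmap F (slice_le (exist _ k h : slice deg i n)) u = (y k - y' k)%R.
    exact: (congr1 (fun w : slice_prod deg F n i => w (exist _ k h)) uP).
  by congr (fmap F _ u); exact: bool_irrelevance.
apply: functional_extensionality_dep => -[k h].
have [ik kn] := set_mem h.
rewrite -[RHS]/(y k - y' k)%R -(uP _ ik kn).
by congr (fmap F _ u); exact: bool_irrelevance.
Qed.

Lemma eq_cls_slice i y y' :
  (forall k, slice deg i n k -> y k = y' k) -> cls i y = cls i y'.
Proof.
by move=> yy'; apply/eq_cls; exists 0%R => k ik kn; rewrite raddf0 yy' ?subrr.
Qed.

Lemma cls0 i : cls i (0 : dprod F)%R = 0%R.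
Proof. exact: raddf0 (coker_pi (lambda deg F n i)). Qed.

End Next.

(** * Rank identities of an adequate covering *)

Section Adequate.
Local Open Scope ring_scope.
Variables (d : Order.disp_t) (P : porderType d) (deg : P -> nat).
Variable J : P -> nat -> set P.
Hypothesis gradedP : graded_poset deg.
Hypothesis coverJ : covering_family deg J.
Hypothesis adequateJ : adequate deg J.
Implicit Types (i j k : P) (p : nat).

(** Adequacy turns the subtracted term of the recursion into the sum over [J i p], which cancels
    part of the sum over the slice. *)
Lemma rkS p i (s : seq P) : (p < deg i)%N -> uniq s ->
    (forall k, slice deg i p k -> k \in s) ->
  rk deg p.+1 i = \sum_(k <- s | k \in slice deg i p `\` J i p) rk deg p k.
Proof.
move=> pi us sl; rewrite /= (adequate_rk adequateJ pi).
have Jsl := cover_sub coverJ (ltnW pi).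
transitivity (\sum_(k <- s | k \in slice deg i p) rk deg p k
              - \sum_(k <- s | k \in J i p) rk deg p k).
  by congr (_ - _); apply: fsbig_seq_widen => // k /Jsl /sl.
rewrite (bigID [pred k | k \in J i p]) /=.
have -> : \sum_(k <- s | (k \in slice deg i p) && (k \in J i p)) rk deg p k
        = \sum_(k <- s | k \in J i p) rk deg p k.
  apply: eq_bigl => k; apply/andb_idl => /set_mem /Jsl; exact: mem_set.
by rewrite addrC addrK; apply: eq_bigl => k; rewrite in_setD.
Qed.

(* The multiplicity [m l] of [l] in the sets [slice j p `\` J j p] is at least
   [l \notin J i0 p]; the rank identity forces the weighted excess to be 0. *)
Lemma unique_block p i0 k : (p.+1 < deg i0)%N ->
    (forall k, deg k = p -> 0 <= rk deg p k) ->
    slice deg i0 p k -> rk deg p k != 0 ->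
  (forall j, J i0 p.+1 j -> slice deg j p k -> J i0 p k -> J j p k) /\
  (forall j j', J i0 p.+1 j -> J i0 p.+1 j' ->
     slice deg j p k -> slice deg j' p k -> ~ J i0 p k -> j = j').
Proof.
move=> pi0 rk_ge0.
have pi0' : (p < deg i0)%N by exact: ltnW.
have Jsl := cover_sub coverJ pi0'.
have fJ : finite_set (J i0 p.+1).
  exact: sub_finite_set (slice_finite gradedP i0 p.+1).
have fs := slice_finite gradedP i0 p.
pose t := finmap.enum_fset (fset_set (J i0 p.+1)).
pose s := finmap.enum_fset (fset_set (slice deg i0 p)).
have us : uniq s by exact: finmap.fset_uniq.
have memt j : (j \in t) = (j \in J i0 p.+1) by rewrite in_fset_set.
have mems l : (l \in s) = (l \in slice deg i0 p) by rewrite in_fset_set.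
pose m l := count (fun j => l \in slice deg j p `\` J j p) t.
have le_m l : l \in s -> ((l \notin J i0 p : nat) <= m l)%N.
  rewrite mems => /set_mem; rewrite -(cover_union coverJ pi0').
  move=> [j Jj lj]; case: (boolP (l \in _)) => //= lJ.
  rewrite -has_count; apply/hasP; exists j; first by rewrite memt; exact/mem_set.
  apply/mem_set; split=> // /(cover_incl coverJ pi0' Jj) lJ'.
  by move: lJ; rewrite mem_set.
have mE l : rk deg p l *+ m l =
    \sum_(j <- t) (if l \in slice deg j p `\` J j p then rk deg p l else 0).
  by rewrite -big_mkcond /= big_const_seq iter_addr_0.
(* By [le_m] the natural subtraction is not truncated. Both parts of the difference equal
   [rk deg p.+1 i0]: one by adequacy at [p.+1] and an exchange of sums, the other by [rkS] at
   [i0]. *)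
have sum0 : \sum_(l <- s) rk deg p l *+ (m l - (l \notin J i0 p)) = 0.
  have -> : \sum_(l <- s) rk deg p l *+ (m l - (l \notin J i0 p)) =
      \sum_(l <- s) rk deg p l *+ m l
      - \sum_(l <- s) rk deg p l *+ (l \notin J i0 p).
    rewrite -sumrB big_seq [RHS]big_seq; apply: eq_bigr => l ls.
    by rewrite mulrnBr ?le_m.
  apply/eqP; rewrite subr_eq0; apply/eqP.
  transitivity (rk deg p.+1 i0).
    rewrite (adequate_rk adequateJ pi0) fsbig_finite //.
    rewrite (eq_bigr _ (fun l _ => mE l)).
    rewrite exchange_big /= big_seq [RHS]big_seq; apply: eq_bigr => j.
    rewrite memt => /set_mem Jj; have [ij jp] := Jsl _ Jj.
    rewrite -[RHS]/(rk deg p.+1 j) (@rkS p j s) ?jp //.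
      by rewrite [RHS]big_mkcond; apply: eq_bigr => l _; case: ifP.
    move=> l [jl lp]; rewrite mems; apply/mem_set; split => //.
    exact: le_trans jl.
  rewrite (@rkS p i0 s) //; last by move=> l ls; rewrite mems; exact/mem_set.
  rewrite big_mkcond big_seq [RHS]big_seq; apply: eq_bigr => l.
  by rewrite mems in_setD => ->; case: (l \notin _).
move=> ks rk0.
have kin : k \in s by rewrite mems; exact/mem_set.
(* A vanishing sum of nonnegative terms has zero terms, so the multiplicity of [k] attains its lower
   bound: 0 if [k] is in [J i0 p], else 1. *)
move/eqP: sum0; rewrite big_seq psumr_eq0; last first.
  by move=> l; rewrite mems => /set_mem[_ /rk_ge0 ?]; exact: mulrn_wge0.
move=> /allP /(_ k kin); rewrite /= kin /= mulrn_eq0 (negbTE rk0) orbF subn_eq0 => mk.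
have memJ j : J i0 p.+1 j -> slice deg j p k -> ~ J j p k ->
    j \in [seq j <- t | k \in slice deg j p `\` J j p].
  by move=> Jj jk nJ; rewrite mem_filter memt (mem_set Jj) andbT; exact/mem_set.
move: mk; rewrite /m -size_filter; split=> [j Jj jk Jk|j j' Jj Jj' jk j'k nJ].
  apply: contrapT => nJ; move: mk (memJ _ Jj jk nJ).
  by rewrite (mem_set Jk) leqn0 size_eq0 => /eqP ->.
have nJJ i : J i0 p.+1 i -> ~ J i p k.
  by move=> Ji /(cover_incl coverJ pi0' Ji).
have := memJ _ Jj' j'k (nJJ _ Jj'); have := memJ _ Jj jk (nJJ _ Jj); move: mk.
case: [seq _ <- _ | _] => [|x [|? ?]] //=; last by case: (_ \notin _).
by rewrite !inE => _ /eqP -> /eqP ->.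
Qed.

(** * Normal forms and the inductive step *)

Definition separated_by_cover (F : functor P) p := forall i, (p < deg i)%N ->
  forall x y : F i,
    (forall j (ij : (i <= j)%O), J i p j -> fmap F ij x = fmap F ij y) -> x = y.

Definition extends_from_cover (F : functor P) p := forall i, (p < deg i)%N ->
  forall z : dprod F,
    exists x : F i, forall j (ij : (i <= j)%O), J i p j -> fmap F ij x = z j.

Definition zero_on (F : functor P) (A : set P) (y : dprod F) :=
  forall k, A k -> y k = 0.

Section Step.
Variables (F : functor P) (p : nat).
Hypothesis sepF : separated_by_cover F p.
Hypothesis extF : extends_from_cover F p.

(** Extend the values of a representative on [J i p] to some [u] in [F i], then subtract the image
    of [u]. *)
Lemma cls_normal_form i (x : next_functor deg F p i) : (p < deg i)%N ->
  exists2 y, zero_on (J i p) y & cls deg p i y = x.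
Proof.
move=> pi; have [y <-] := cls_surj x; have [u uP] := extF pi y.
(* The image of [u] under [lambda], made a total family by zero off the objects above [i]. *)
pose lu : dprod F := fun k =>
  if pselect (i <= k)%O is left ik return F k then fmap F ik u else 0.
have luE k (ik : (i <= k)%O) : lu k = fmap F ik u.
  rewrite /lu; case: pselect => // ik'.
  by congr (fmap F _ u); exact: bool_irrelevance.
exists (fun k => y k - lu k) => [k Jk|].
  have [ik _] := cover_sub coverJ (ltnW pi) Jk.
  by rewrite (luE _ ik) uP // subrr.
apply/eq_cls; exists (- u) => k ik _.
by rewrite raddfN -luE addrAC subrr add0r.
Qed.

(** The difference comes from some [u] in [F i] that vanishes on [J i p], hence [u = 0] by
    separation. *)
Lemma cls_normal_inj i (y y' : dprod F) : (p < deg i)%N ->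
    zero_on (J i p) y -> zero_on (J i p) y' ->
  cls deg p i y = cls deg p i y' ->
  forall k, slice deg i p k -> y k = y' k.
Proof.
move=> pi y0 y'0 /eq_cls[u uP].
have u0 : u = 0.
  apply: (sepF pi) => j ij Jj; rewrite raddf0.
  have [_ jp] := cover_sub coverJ (ltnW pi) Jj.
  by rewrite uP // y0 // y'0 // subrr.
by move=> k [ik kp]; apply/subr0_eq; rewrite -(uP k ik kp) u0 raddf0.
Qed.

Lemma next_separated : separated_by_cover (next_functor deg F p) p.+1.
Proof.
move=> i pi x x' xx'.
have pi' : (p < deg i)%N by exact: ltnW.
have [[y y0 yE] [y' y'0 y'E]] := (cls_normal_form x pi', cls_normal_form x' pi').
rewrite -yE -y'E; apply: eq_cls_slice => k.
rewrite -(cover_union coverJ pi') => -[j Jj].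
have [ij jp] := cover_sub coverJ pi' Jj.
have JJ := cover_incl coverJ pi' Jj.
apply: cls_normal_inj; first by rewrite jp.
- by move=> l /JJ /y0.
- by move=> l /JJ /y'0.
- by rewrite -!(fmap_cls _ _ ij) yE y'E xx'.
Qed.

Hypothesis rk_ge0 : forall k, deg k = p -> 0 <= rk deg p k.
Hypothesis rk_eq0 : forall k,
  deg k = p -> rk deg p k = 0 -> forall x : F k, x = 0.

Lemma next_extends : extends_from_cover (next_functor deg F p) p.+1.
Proof.
move=> i pi z; have pi' : (p < deg i)%N by exact: ltnW.
have /choice[w wP] j : exists y : dprod F, deg j = p.+1 ->
    zero_on (J j p) y /\ cls deg p j y = z j.
  have [jp|njp] := pselect (deg j = p.+1); last by exists (fun=> 0).
  have pj : (p < deg j)%N by rewrite jp.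
  by have [y y0 yE] := cls_normal_form (z j) pj; exists y.
(* [b k] selects a block containing [k]; the default [i] only occurs when no block does. *)
have /choice[b bP] k : exists j, forall j', J i p.+1 j' -> slice deg j' p k ->
    J i p.+1 j /\ slice deg j p k.
  have [[j Jj jk]|nj] := pselect (exists2 j, J i p.+1 j & slice deg j p k).
    by exists j.
  by exists i => j' Jj' jk'; case: nj; exists j'.
pose y : dprod F := fun k => if k \in J i p then 0 else w (b k) k.
exists (cls deg p i y) => j ij Jj; rewrite fmap_cls.
have [_ jp] := cover_sub coverJ pi' Jj.
have [wj0 <-] := wP j jp; apply: eq_cls_slice => k jk.
have [[_ kp] [Jb bk]] := (jk, bP k j Jj jk).
have ik : slice deg i p k by split=> //; exact: le_trans ij jk.1.
(* Blocks may overlap at [k] of rank 0, but there [F k] is zero and all values agree. *)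
have [rk0|rk0] := eqVneq (rk deg p k) 0; first by rewrite !(rk_eq0 kp rk0 (_ k)).
have [inJ uniqJ] := unique_block pi rk_ge0 ik rk0.
rewrite /y; case: ifPn => [/set_mem Jk|/negP nJk].
  by rewrite wj0 //; exact: inJ.
by rewrite (uniqJ (b k) j) // => Jk; apply: nJk; exact/mem_set.
Qed.

Lemma rkS_ge0 i : (p < deg i)%N -> 0 <= rk deg p.+1 i.
Proof.
move=> pi; rewrite (@rkS p i (finmap.enum_fset (fset_set (slice deg i p)))) //.
- by apply: sumr_ge0 => k /set_mem[[_ kp] _]; exact: rk_ge0.
- exact: finmap.fset_uniq.
- by move=> k ik; rewrite in_fset_set ?inE //; exact: slice_finite gradedP _ _.
Qed.

(** Off [J i p] every rank is 0, being a nonnegative term of a zero sum; so a normal form vanishes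
    on the whole slice. *)
Lemma next_eq0 i : (p < deg i)%N -> rk deg p.+1 i = 0 ->
  forall x : next_functor deg F p i, x = 0.
Proof.
move=> pi rk0 x; have [y y0 <-] := cls_normal_form x pi.
rewrite -(cls0 deg F p i); apply: eq_cls_slice => k ik.
have [Jk|nJk] := pselect (J i p k).
  by rewrite y0.
apply: rk_eq0; first by case: ik.
move: rk0; rewrite (@rkS p i (finmap.enum_fset (fset_set (slice deg i p)))) //.
- move=> /eqP; rewrite psumr_eq0; last first.
    by move=> l /set_mem[[_ lp] _]; exact: rk_ge0.
  move=> /allP /(_ k); rewrite in_fset_set ?inE; last first.
    exact: slice_finite gradedP _ _.
  by move=> /(_ ik) /implyP h; apply/eqP/h; apply/mem_set.
- exact: finmap.fset_uniq.
- by move=> l il; rewrite in_fset_set ?inE //; exact: slice_finite gradedP _ _.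
Qed.

End Step.

(** * Vanishing in low degrees and the induction on [p] *)

Lemma deg_le i j : (i <= j)%O -> (deg j <= deg i)%N.
Proof.
by rewrite le_eqVlt => /predU1P[->//|/(deg_decr gradedP)/ltnW].
Qed.

Lemma le_deg_eq i j : (i <= j)%O -> (deg i <= deg j)%N -> i = j.
Proof.
by rewrite le_eqVlt => /predU1P[//|/(deg_decr gradedP)]; rewrite ltnNge => /negP.
Qed.

(** The slice is empty or reduces to [i] itself; in the latter case [lambda] is onto, with [y i] as
    preimage. *)
Lemma Fseq_vanish p i : (deg i < p)%N -> forall x : Fseq deg p i, x = 0.
Proof.
case: p => [|p] // ip x; have [y <-] := cls_surj x.
rewrite -(cls0 deg (Fseq deg p) p i); apply/eq_cls; exists (y i) => k ik kp.
have ek : i = k by apply: le_deg_eq => //; rewrite kp.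
by case: _ / ek ik kp => ii _; rewrite fmap_id subr0.
Qed.

(** The rank clauses join the induction because gluing at the next stage relies on them. *)
Lemma Fseq_cover p :
  [/\ separated_by_cover (Fseq deg p) p, extends_from_cover (Fseq deg p) p,
      forall i, (p <= deg i)%N -> 0 <= rk deg p i
    & forall i, (p <= deg i)%N -> rk deg p i = 0 ->
        forall x : Fseq deg p i, x = 0].
Proof.
elim: p => [|p [sepF extF rk_ge0 rk_eq0]]; last first.
  have rk_ge0' k : deg k = p -> 0 <= rk deg p k by move=> kp; rewrite rk_ge0 ?kp.
  have rk_eq0' k : deg k = p -> rk deg p k = 0 -> forall x : Fseq deg p k, x = 0.
    by move=> kp; apply: rk_eq0; rewrite kp.
  split; first exact: next_separated.
  - exact: next_extends.
  - exact: rkS_ge0.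
  - exact: next_eq0.
(* Base case: all ranks are 1, so adequacy counts [J i 0] as a singleton. *)
have cover1 i : (0 < deg i)%N -> exists j, J i 0 = [set j].
  move=> i0; have Jsl := cover_sub coverJ (ltnW i0).
  have fJ : finite_set (J i 0%N).
    exact: sub_finite_set (slice_finite gradedP i 0%N).
  have := adequate_rk adequateJ i0; rewrite fsbig_finite //= big_const_seq.
  rewrite count_predT iter_addr_0 => /esym/eqP; rewrite pnatr_eq1.
  set t := finmap.enum_fset _ => t1.
  have memt j : (j \in t) = (j \in J i 0%N) by rewrite in_fset_set.
  case: t t1 memt => [|j [|? ?]] // _ memt; exists j.
  apply/seteqP; split=> k; first by move/mem_set; rewrite -memt inE => /eqP.
  by move=> ->; apply: set_mem; rewrite -memt inE.
split=> // [i /cover1[j Jj] x y xy|i /cover1[j Jj] z].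
- have Jij : J i 0%N j by rewrite Jj.
  have [|ij _] := cover_sub coverJ _ Jij; first by [].
  exact: xy ij Jij.
- by exists (z j) => k ik; rewrite Jj => kj; case: _ / (esym kj) ik.
Qed.

(** * Comparison of the two limits *)

Section Limit.
Variables (F : functor P) (p : nat).
Hypothesis sepF : separated_by_cover F p.
Hypothesis extF : extends_from_cover F p.
Hypothesis vanishF : forall i, (deg i < p)%N -> forall x : F i, x = 0.

Variable A : set P.
Hypothesis A_deg : forall i, A i <-> deg i = p.+1 \/ deg i = p.

Lemma restrict_compatible (x : limit F) :
  compatible (F := restrict_functor A F) (fun v => limit_val x (val v)).
Proof.
by apply/asboolP => v w vw; have /asboolP := limitP x; exact.
Qed.

Definition restrict_limit (x : limit F) : limit (restrict_functor A F) :=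
  Limit (restrict_compatible x).

Lemma restrict_limit_zmod_morphism : zmod_morphism restrict_limit.
Proof. by move=> x y; apply: val_inj. Qed.

HB.instance Definition _ :=
  GRing.isZmodMorphism.Build _ _ restrict_limit restrict_limit_zmod_morphism.

Lemma restrict_limit_inj : injective restrict_limit.
Proof.
move=> x y xy.
have xyA i : A i -> limit_val x i = limit_val y i.
  move=> /mem_set Ai.
  by have /(congr1 (fun u => limit_val u (Subposet Ai))) := xy.
have /asboolP xP := limitP x; have /asboolP yP := limitP y.
apply: val_inj; apply: functional_extensionality_dep => i /=.
have [ip|pi|ip] := ltngtP (deg i) p.
- by rewrite [LHS]vanishF // [RHS]vanishF.
- apply: (sepF pi) => j ij Jj; rewrite xP yP; apply: xyA.
  by apply/A_deg; right; have [] := cover_sub coverJ (ltnW pi) Jj.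
- by apply: xyA; apply/A_deg; right.
Qed.

Lemma restrict_limit_surj (z : limit (restrict_functor A F)) :
  exists x, restrict_limit x = z.
Proof.
pose y : dprod F := fun k =>
  if pselect (k \in A) is left Ak return F k
  then limit_val z (Subposet Ak) else 0.
have zy v : limit_val z v = y (val v).
  rewrite /y; case: v => k Ak /=; case: pselect => // Ak'.
  by rewrite (bool_irrelevance Ak Ak').
have yP i j (ij : (i <= j)%O) : A i -> A j -> fmap F ij (y i) = y j.
  move=> /mem_set Ai /mem_set Aj; have /asboolP := limitP z.
  by move=> /(_ (Subposet Ai) (Subposet Aj) ij); rewrite !zy.
have Ap i : deg i = p -> A i by move=> ip; apply/A_deg; right.
have ApS i : deg i = p.+1 -> A i by move=> ip; apply/A_deg; left.
(* Below degree [p] the value is zero, in degree [p] it is prescribed, and above it is extended from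
   [J i p]. *)
have /(_ _)/cid xE i : exists u : F i, (deg i = p -> u = y i) /\
    ((p < deg i)%N -> forall j (ij : (i <= j)%O), J i p j -> fmap F ij u = y j).
  have [ip|pi|ip] := ltngtP (deg i) p.
  - by exists 0; split=> // ip'; rewrite ip' ltnn in ip.
  - by have [u uP] := extF pi y; exists u; split=> // ip; rewrite ip ltnn in pi.
  - by exists (y i).
pose x i := sval (xE i).
have xP i : (deg i = p -> x i = y i) /\ ((p < deg i)%N ->
    forall j (ij : (i <= j)%O), J i p j -> fmap F ij (x i) = y j).
  exact: svalP (xE i).
(* By (a), [k] lies above some [j] in [J i p.+1]. The image of [x i] at [j] agrees with [y j] on
   [J j p] by (b), hence equals it by separation; compatibility along [j <= k] concludes. *)
have xy i k (ik : (i <= k)%O) : deg k = p -> fmap F ik (x i) = y k.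
  move=> kp; have [xpE xpP] := xP i.
  have := deg_le ik; rewrite kp leq_eqVlt => /predU1P[/esym ip|pi].
    by rewrite xpE // yP //; exact: Ap.
  have : slice deg i p k by [].
  rewrite -(cover_union coverJ pi) => -[j Jj [jk _]].
  have [ij jp] := cover_sub coverJ pi Jj.
  have xj : fmap F ij (x i) = y j.
    apply: sepF; first by rewrite jp.
    move=> l jl Jl; have [_ lp] : slice deg j p l.
      by apply: (cover_sub coverJ) Jl; rewrite jp.
    rewrite -(fmap_comp ij jl (le_trans ij jl)) xpP //.
      by rewrite yP //; [exact: ApS|exact: Ap].
    exact: (cover_incl coverJ pi Jj).
  by rewrite (fmap_comp ij jk ik) xj yP //; [exact: ApS|exact: Ap].
have x_compatible : compatible (F := F) x.
  apply/asboolP => i j ij; have [jp|pj|jp] := ltngtP (deg j) p.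
  - by rewrite [LHS]vanishF // [RHS]vanishF.
  - apply: (sepF pj) => l jl Jl.
    have [_ lp] := cover_sub coverJ (ltnW pj) Jl.
    by rewrite -(fmap_comp ij jl (le_trans ij jl)) !xy.
  - by rewrite xy // (xP j).1.
exists (Limit x_compatible); apply: val_inj.
apply: functional_extensionality_dep => v /=; rewrite zy.
(* In degree [p.+1] the value was defined only through [J], so it is matched with [z] by
   separation. *)
have /A_deg[vp|vp] := set_mem (valP v); last by rewrite (xP _).1.
have pv : (p < deg (val v))%N by rewrite vp.
apply: (sepF pv) => l vl Jl.
have [_ lp] := cover_sub coverJ (ltnW pv) Jl.
by rewrite xy // yP //; [exact: ApS|exact: Ap].
Qed.

Lemma restrict_limit_bij : bijective restrict_limit.
Proof.
have [g gK] := choice restrict_limit_surj.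
by exists g => // x; apply: restrict_limit_inj; rewrite gK.
Qed.

End Limit.

End Adequate.

Theorem lemma5p3p1 (d : Order.disp_t) (P : porderType d) (deg : P -> nat)
    (gradedP : graded_poset deg)
    (J : P -> nat -> set P)
    (coverJ : covering_family deg J) (adequateJ : adequate deg J) (p : nat) :
  exists f : {additive limit (Fseq deg p) ->
      limit (restrict_functor [set i | deg i = p.+1 \/ deg i = p] (Fseq deg p))},
    bijective f.
Proof.
have [sepF extF _ _] := Fseq_cover gradedP coverJ adequateJ p.
exists (@restrict_limit _ _ (Fseq deg p) _).
exact: (restrict_limit_bij gradedP coverJ sepF extF (Fseq_vanish gradedP (p := p))).
Qed.
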